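(* Let $f$ and $g$ be partial Boolean functions and $\epsilon\ge0$. Then $\bar{\mathrm{R}}_\epsilon(f\circ g)\ge\bar{\mathrm{R}}_\epsilon(f)\,\mathrm{RS}(g)$.
   Context: A partial Boolean function on $n$ bits is $f:\mathrm{Dom}(f)\to\{0,1\}$ with $\mathrm{Dom}(f)\subseteq\{0,1\}^n$. For $f$ on $n$ bits and $g$ on $k$ bits, $f\circ g$ is the partial function on $nk$ bits with domain $\{(x_1,\dots,x_n):x_i\in\mathrm{Dom}(g),(g(x_1),\dots,g(x_n))\in\mathrm{Dom}(f)\}$ and value $f(g(x_1),\dots,g(x_n))$. A randomized query algorithm is a probability distribution over deterministic decision trees; it has error $\epsilon$ if on every input in the domain it is correct with probability at least $1-\epsilon$. $\bar{\mathrm{R}}_\epsilon(h)$ is the minimum, over error-$\epsilon$ algorithms, of the maximum over inputs of the expected number of queries; $\mathrm{R}_0(h)=\bar{\mathrm{R}}_0(h)$. Query notions apply to alphabet $\{0,1,*,\dagger\}$. Sabotage: $P_g\subseteq\{0,1,*\}^k$ is the set of $p$ for which there exist $x,y\in\mathrm{Dom}(g)$ with $g(x)\ne g(y)$ and $x_i=y_i=p_i$ whenever $p_i\ne*$; $P_g^\dagger$ is the same with $\dagger$ in place of $*$; $Q_g=P_g\cup P_g^\dagger$; $g_{\mathrm{sab}}:Q_g\to\{0,1\}$ is $0$ on $P_g$ and $1$ on $P_g^\dagger$; $\mathrm{RS}(g)=\mathrm{R}_0(g_{\mathrm{sab}})$. *)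

(* Defs.v *)
From HB Require Import structures.
From mathcomp Require Import all_boot all_order all_algebra.
From mathcomp Require Import all_classical all_reals all_analysis.

Set Implicit Arguments.
Unset Strict Implicit.
Unset Printing Implicit Defensive.

Import Order.TTheory GRing.Theory Num.Theory.

Local Open Scope ring_scope.

(* A partial function from strings of length [n] over the alphabet [S] to
   {0,1}; the domain consists of the strings that are not mapped to [None]. *)
Definition pfun (S : finType) (n : nat) := {ffun 'I_n -> S} -> option bool.

Definition dom (S : finType) (n : nat) (h : pfun S n) : pred {ffun 'I_n -> S} :=
  fun x => isSome (h x).

(* Trees may query a position several times along a path; every occurrence
   counts as a query. *)
Inductive dtree (S : finType) (n : nat) : Type :=
| Answer of bool
| Query of 'I_n & (S -> dtree S n).

Arguments Answer {S n} _.
Arguments Query {S n} _ _.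

Fixpoint output (S : finType) (n : nat) (t : dtree S n) (x : {ffun 'I_n -> S})
    : bool :=
  match t with
  | Answer b => b
  | Query i next => output (next (x i)) x
  end.

Fixpoint nqueries (S : finType) (n : nat) (t : dtree S n)
    (x : {ffun 'I_n -> S}) : nat :=
  match t with
  | Answer _ => 0
  | Query i next => (nqueries (next (x i)) x).+1
  end.

(* As [S] is finite there are only countably many trees, so the discrete
   sigma-algebra allows every probability distribution over trees. *)
HB.instance Definition _ (S : finType) (n : nat) := gen_eqMixin (dtree S n).
HB.instance Definition _ (S : finType) (n : nat) := gen_choiceMixin (dtree S n).
HB.instance Definition _ (S : finType) (n : nat) :=
  isPointed.Build (dtree S n) (Answer false).
HB.instance Definition _ (S : finType) (n : nat) :=
  @isMeasurable.Build default_measure_display (dtree S n)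
    (@discrete_measurable (dtree S n)) (@discrete_measurable0 (dtree S n))
    (@discrete_measurableC (dtree S n)) (@discrete_measurableU (dtree S n)).

Definition ralg (R : realType) (S : finType) (n : nat) :=
  probability (dtree S n) R.

Definition has_error (R : realType) (S : finType) (n : nat) (eps : R)
    (h : pfun S n) (A : ralg R S n) : Prop :=
  forall (x : {ffun 'I_n -> S}) (b : bool), h x = Some b ->
    ((1 - eps)%:E <= A [set t | output t x = b]%classic)%E.

Definition expected_queries (R : realType) (S : finType) (n : nat)
    (A : ralg R S n) (x : {ffun 'I_n -> S}) : \bar R :=
  ('E_A[fun t => (nqueries t x)%:R])%E.

(* The maximum over an empty domain is 0. *)
Definition worst_case_queries (R : realType) (S : finType) (n : nat)
    (h : pfun S n) (A : ralg R S n) : \bar R :=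
  \big[maxe/0%E]_(x | dom h x) expected_queries A x.

(* The infimum is a minimum: trees that never repeat a query suffice, and there
   are finitely many of them. *)
Definition Rbar (R : realType) (S : finType) (n : nat) (eps : R)
    (h : pfun S n) : \bar R :=
  ereal_inf [set worst_case_queries h A | A in [set A | has_error eps h A]]%classic.

Definition R0 (R : realType) (S : finType) (n : nat) (h : pfun S n) : \bar R :=
  Rbar (0 : R) h.

(* Bit [j] of block [i] sits at position [i * k + j]. *)
Definition block (n k : nat) (x : {ffun 'I_(n * k) -> bool}) (i : 'I_n)
    : {ffun 'I_k -> bool} :=
  [ffun j => x (mxvec_index i j)].

(* The default value [false] is never used, since it occurs only under the test
   that every block lies in the domain of [g]. *)
Definition compose (n k : nat) (f : pfun bool n) (g : pfun bool k)
    : pfun bool (n * k) :=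
  fun x => if [forall i, dom g (block x i)]
           then f [ffun i => odflt false (g (block x i))]
           else None.

Inductive sabchar := Bit of bool | Star | Dagger.

Definition sabchar_code (c : sabchar) : bool + bool :=
  match c with Bit b => inl b | Star => inr false | Dagger => inr true end.
Definition sabchar_decode (c : bool + bool) : sabchar :=
  match c with inl b => Bit b | inr false => Star | inr true => Dagger end.
Lemma sabchar_codeK : cancel sabchar_code sabchar_decode.
Proof. by case. Qed.
HB.instance Definition _ := Finite.copy sabchar (can_type sabchar_codeK).

(* [sab_inputs Star g] is P_g and [sab_inputs Dagger g] is its dagger version.
   The last condition also forces every character of [p] to be a bit or [c]. *)
Definition sab_inputs (k : nat) (c : sabchar) (g : pfun bool k)
    : {set {ffun 'I_k -> sabchar}} :=
  [set p : {ffun 'I_k -> sabchar} |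
    [exists x : {ffun 'I_k -> bool}, exists y : {ffun 'I_k -> bool},
      [&& dom g x, dom g y, g x != g y &
        [forall i, (p i != c) ==> (Bit (x i) == p i) && (Bit (y i) == p i)]]]].

(* The two branches do not overlap: an element of both sets would be a bit
   string [p] with x = y = p but g(x) <> g(y). *)
Definition gsab (k : nat) (g : pfun bool k) : pfun sabchar k :=
  fun p => if p \in sab_inputs Star g then Some false
           else if p \in sab_inputs Dagger g then Some true
           else None.

Definition RS (R : realType) (k : nat) (g : pfun bool k) : \bar R :=
  R0 R (gsab g).

(* Main.v *)
From HB Require Import structures.
Require Import Defs.
From mathcomp Require Import all_boot all_order all_algebra.
From mathcomp Require Import all_classical all_reals all_analysis.
From mathcomp Require Import measurable_realfun.
From mathcomp Require Import ring lra.

(* Represent a sabotaged input by a pair (x, y) with g x = 0 and g y = 1, the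
   sabotaged positions being those where x and y differ.  Let r = RS(g).  For
   every randomized tree there is a pair on which the expected number of queries
   up to the first sabotaged position is at least r times the probability of
   reaching one: otherwise, running the tree and, on failure, a nearly optimal
   algorithm for g_sab would have worst-case cost below r.  By minimax, some
   distribution mu on pairs achieves this against all deterministic trees.

   Given an algorithm for f o g, solve f on z by drawing pairs (x_i, y_i)
   independently from mu and simulating the algorithm on the input whose i-th
   block is x_i if z_i = 0 and y_i if z_i = 1; the bit z_i is needed only once a
   sabotaged position of block i is read.  Conditioned on the other blocks, the
   simulated tree acts on block i as a tree for mu, so on average it makes
   at least r queries in block i per query to z_i. *)

Set Implicit Arguments.
Unset Strict Implicit.
Unset Printing Implicit Defensive.

Import Order.TTheory GRing.Theory Num.Theory.

Local Open Scope ring_scope.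

(** * A theorem of the alternative *)

Section Ville.
Context {R : realType} {T : Type}.
Implicit Types (s : seq (R * T)) (h : T -> R).

(** A weighted list is an unnormalized finite mixture, so [T] itself may be infinite, as the type of
    trees is. *)
Definition nonneg_comb s := all (fun x => 0 <= x.1) s.
Definition comb h s : R := \sum_(x <- s) x.1 * h x.2.
Definition mix (a : R) s (b : R) s' : seq (R * T) :=
  [seq (a * x.1, x.2) | x <- s] ++ [seq (b * x.1, x.2) | x <- s'].

Lemma nonneg_comb_mix a s b s' : 0 <= a -> 0 <= b ->
  nonneg_comb s -> nonneg_comb s' -> nonneg_comb (mix a s b s').
Proof.
move=> a0 b0 s0 s0'; rewrite /nonneg_comb all_cat !all_map; apply/andP; split.
  by apply: sub_all s0 => x /= /(mulr_ge0 a0).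
by apply: sub_all s0' => x /= /(mulr_ge0 b0).
Qed.

Lemma comb_mix h a s b s' : comb h (mix a s b s') = a * comb h s + b * comb h s'.
Proof.
rewrite /comb big_cat !big_map !big_distrr /=.
by congr (_ + _); apply: eq_bigr => x _; rewrite mulrA.
Qed.

Lemma combD (a b : R) h h' s :
  comb (fun t => a * h t + b * h' t) s = a * comb h s + b * comb h' s.
Proof.
rewrite /comb !big_distrr -big_split /=.
by apply: eq_bigr => x _; ring.
Qed.

(* The weight [l] slides from the first functional [h0] to the second one
   [h1]; [u] and [w] are combinations violating the merged constraint, one
   through [h0] and the other through [h1], and a combination of both violates
   [h0] and [h1] simultaneously. *)
Lemma merge_functionals (h0 h1 : T -> R) (P : seq (R * T) -> Prop) :
    (forall (a : R) s (b : R) s', 0 < a -> 0 <= b -> P s -> P s' -> P (mix a s b s')) ->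
    (forall s, P s -> 0 <= comb h0 s \/ 0 <= comb h1 s) ->
  exists2 l : R, 0 <= l <= 1 &
    forall s, P s -> 0 <= (1 - l) * comb h0 s + l * comb h1 s.
Proof.
move=> Pmix PP; apply: contrapT => nex.
have neg (l : R) : 0 <= l <= 1 ->
    exists2 s, P s & (1 - l) * comb h0 s + l * comb h1 s < 0.
  move=> l01; apply: contrapT => ns; apply: nex; exists l => // s Ps.
  by rewrite leNgt; apply/negP => sl; apply: ns; exists s.
(* [S] collects the weights at which the constraint fails through [h0]; at its supremum [L] the
   failure must pass to [h1]. *)
pose S : set R := [set l : R | 0 <= l <= 1 /\ exists s,
  [/\ P s, comb h0 s < 0 & (1 - l) * comb h0 s + l * comb h1 s < 0]]%classic.
have S0 : S 0.
  split; first by rewrite lexx ler01.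
  have [|s Ps] := neg 0; first by rewrite lexx ler01.
  by rewrite subr0 mul1r mul0r addr0 => sl; exists s; split=> //; lra.
have S1 : ubound S 1 by move=> l [/andP[]].
have hS : has_sup S by split; [exists 0 | exists 1].
set L := sup S.
have L0 : 0 <= L by apply: ub_le_sup => //; exists 1.
have L1 : L <= 1 by apply: ge_sup => //; exists 0.
have [|s Ps sL] := neg L; first by rewrite L0.
set a := comb h0 s in sL; set b := comb h1 s in sL.
set M := _ + _ in sL.
have := PP _ Ps; rewrite -/a -/b.
have [a0 [|b0]|a0 _] := ltP a 0; first by move=> ?; lra.
  have Llt1 : L < 1.
    by rewrite lt_neqAle L1 andbT; apply/eqP => Le; move: sL; rewrite /M Le; lra.
  (* Half the step that would raise [M] to zero, capped so that [L + e] stays at most 1: [s] would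
     put [L + e] in [S]. *)
  pose e := Num.min (1 - L) (- M / (2 * (b - a))).
  have e0 : 0 < e by rewrite /e lt_min subr_gt0 Llt1 /= divr_gt0 //; lra.
  have eM : e * (b - a) <= - M / 2.
    have : e <= - M / (2 * (b - a)) by rewrite /e ge_min lexx orbT.
    rewrite ler_pdivlMr; lra.
  have : L + e <= L; last lra.
  apply: ub_le_sup; first by exists 1.
  have e1 : e <= 1 - L by rewrite /e ge_min lexx.
  split; first lra.
  by exists s; split=> //; rewrite -/a -/b; move: eM sL; rewrite /M; lra.
have b0 : b < 0.
  rewrite ltNge; apply/negP => b0; move: sL; rewrite /M ltNge => /negP; apply.
  by apply: addr_ge0; apply: mulr_ge0 => //; lra.
(* The distance to [L] is small enough for [s] to violate the constraint at [l] as well as [s']. *)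
have [l [/andP[l0 l1] [s' [Ps' a'0 sl']]] lL] : exists2 l, S l & L - - M / (a - b) < l.
  by apply: sup_adherent => //; apply: divr_gt0; lra.
set a' := comb h0 s' in a'0 sl'; set b' := comb h1 s' in sl'.
have b'0 : 0 <= b' by case: (PP _ Ps'); rewrite -/a' -/b' //; lra.
have sl : (1 - l) * a + l * b < 0.
  have : (L - l) * (a - b) < - M by rewrite -ltr_pdivlMr; lra.
  by rewrite /M; lra.
(* Weights [- b] on [s'] and [b'] on [s] cancel the [h1] value; [c] is the [h0] value that
   remains. *)
set c := - b * a' + b' * a.
have c0 : c < 0.
  have : (1 - l) * c < 0.
    have -> : (1 - l) * c = - b * ((1 - l) * a' + l * b') + b' * ((1 - l) * a + l * b).
      by rewrite /c; ring.
    have : - b * ((1 - l) * a' + l * b') < 0 by rewrite pmulr_rlt0 //; lra.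
    have : b' * ((1 - l) * a + l * b) <= 0 by apply: mulr_ge0_le0 => //; lra.
    lra.
  by rewrite pmulr_rlt0 // lt_neqAle subr_ge0 l1 andbT;
     apply/eqP => l1'; move: sl'; nra.
(* Adding [- q] to the weight of [s] turns the values into [q] for [h0] and [- q * b] for [h1], both
   negative. The denominator is [a + 1] because [a] may be 0. *)
pose q := c / (a + 1).
have qE : q * a + q = c by rewrite /q; field; lra.
have q0 : q < 0 by rewrite pmulr_llt0 // invr_gt0; lra.
have Pm : P (mix (- b) s' (b' - q) s) by apply: Pmix => //; lra.
have qb : 0 < q * b by rewrite nmulr_rgt0.
by case: (PP _ Pm); rewrite comb_mix -/a -/b -/a' -/b' => ?; move: qE; rewrite /c; lra.
Qed.

(** Induction on the number of functionals: the first two are merged, and the mass of the merged one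
    is split in proportions [1 - l] and [l]. Merging concerns only combinations negative on all the
    others, where the hypothesis leaves one of the first two. *)
Lemma ville_nat m (v : T -> nat -> R) :
    (forall s, nonneg_comb s -> exists2 i, (i < m.+1)%N & 0 <= comb (v^~ i) s) ->
  exists mu : nat -> R, [/\ forall i, 0 <= mu i, \sum_(i < m.+1) mu i = 1 &
    forall t, 0 <= \sum_(i < m.+1) mu i * v t i].
Proof.
elim: m v => [|m IH] v hv.
  exists (fun=> 1); split=> //; first by rewrite big_ord1.
  move=> t; rewrite big_ord1 /= mul1r.
  have [|[|//] _] := hv [:: (1, t)]; first by rewrite /nonneg_comb /= ler01.
  by rewrite /comb big_seq1 /= mul1r.
have [|s [s0 sr]|l /andP[l0 l1] hl] := @merge_functionals (v^~ 0%N) (v^~ 1%N)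
  (fun s => nonneg_comb s /\ forall i, (i < m)%N -> comb (v^~ i.+2) s < 0).
- move=> a s b s' a0 b0 [s0 sr] [s'0 s'r]; split.
    by apply: nonneg_comb_mix => //; exact: ltW.
  move=> i im; rewrite comb_mix; have := sr _ im; have := s'r _ im.
  move=> y x; have := mulr_ge0_le0 b0 (ltW y).
  by have : a * comb (v^~ i.+2) s < 0; [rewrite pmulr_rlt0|lra].
- have [[|[|i]]] := hv _ s0; [by left|by right|].
  by rewrite !ltnS => /sr; lra.
pose v' t i := if i is i'.+1 then v t i'.+2 else (1 - l) * v t 0%N + l * v t 1%N.
have [|mu [mu0 mu1 muv]] := IH v'.
  move=> s s0; apply: contrapT => ns.
  have vs i : (i < m.+1)%N -> comb (v'^~ i) s < 0.
    by move=> im; rewrite ltNge; apply/negP => vi; apply: ns; exists i.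
  have := vs 0%N isT; rewrite /v' combD ltNge => /negP; apply.
  by apply: hl; split=> // i im; exact: (vs i.+1).
exists (fun i => match i with
  0%N => (1 - l) * mu 0%N | 1%N => l * mu 0%N | i'.+2 => mu i'.+1 end).
split.
- by move=> [|[|i]]; rewrite ?mulr_ge0 // subr_ge0.
- by rewrite -[RHS]mu1 !big_ord_recl /= addrA -mulrDl subrK mul1r.
- move=> t; have := muv t; rewrite !big_ord_recl /= mulrDr !addrA.
  by rewrite !mulrA -!(mulrC (mu 0%N)).
Qed.

Lemma ville (I : finType) (v : T -> I -> R) :
    (forall s, nonneg_comb s -> exists i, 0 <= comb (v^~ i) s) ->
  exists mu : I -> R, [/\ forall i, 0 <= mu i, \sum_i mu i = 1 &
    forall t, 0 <= \sum_i mu i * v t i].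
Proof.
(* The empty combination shows that [I] is inhabited. *)
move=> hv; have [i0 _] := hv [::] isT.
pose f j := nth i0 (enum I) j.
have card : (#|I|.-1.+1 = #|I|)%N by rewrite prednK //; apply/card_gt0P; exists i0.
have [|mu [mu0 mu1 muv]] := @ville_nat #|I|.-1 (fun t j => v t (f j)).
  move=> s s0; have [i vi] := hv _ s0; exists (enum_rank i).
    by rewrite card ltn_ord.
  by rewrite /f nth_enum_rank.
rewrite card in mu1 muv.
exists (fun i => mu (enum_rank i)); split=> [//||t].
  rewrite -mu1 (reindex_onto enum_val enum_rank) => [|i _]; last exact: enum_rankK.
  by apply: eq_big => j; rewrite enum_valK ?eqxx.
have := muv t; congr (0 <= _); apply/esym.
rewrite (reindex_onto enum_val enum_rank) => [|i _]; last exact: enum_rankK.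
apply: eq_big => j; first by rewrite enum_valK eqxx.
by rewrite enum_valK /f -(enum_val_nth i0).
Qed.

End Ville.

(** * Mixtures of randomized algorithms *)

Lemma ex_measure_sum d (T : measurableType d) (R : realType) (J : Type)
    (r : seq J) (w : J -> R) (m : J -> {measure set T -> \bar R}) :
    (forall j, 0 <= w j) ->
  exists M : {measure set T -> \bar R},
    (forall E, M E = \sum_(j <- r) (w j)%:E * m j E)%E /\
    (forall h : T -> \bar R, measurable_fun [set: T] h -> (forall x, 0 <= h x)%E ->
      (\int[M]_x h x = \sum_(j <- r) (w j)%:E * \int[m j]_x h x)%E).
Proof.
move=> w0; elim: r => [|j r [M [ME Mh]]].
  exists mzero; split=> [E|h mh h0]; rewrite big_nil //.
  exact: integral_measure_zero.
exists (measure_add (mscale (NngNum (w0 j)) (m j)) M); split=> [E|h mh h0].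
  by rewrite big_cons -ME; exact: measure_addE.
by rewrite ge0_integral_measure_add // ge0_integral_mscale // big_cons Mh.
Qed.

Section ProbabilityOfMeasure.
Context {d : measure_display} {T : measurableType d} {R : realType}.
Variables (M : {measure set T -> \bar R}) (M1 : M setT = 1%E).

(** An alias that carries the proof of total mass 1, so that a probability structure can be attached
    to it. *)
Definition probability_of_measure of M setT = 1%E : set T -> \bar R := M.

HB.instance Definition _ := Measure.copy (probability_of_measure M1) M.
HB.instance Definition _ :=
  Measure_isProbability.Build _ _ _ (probability_of_measure M1) M1.

End ProbabilityOfMeasure.

Section Costs.
Context {R : realType} {S : finType} {n : nat}.

Lemma expected_queriesE (A : ralg R S n) x :
  expected_queries A x = (\int[A]_t (nqueries t x)%:R%:E)%E.
Proof. by rewrite /expected_queries unlock. Qed.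

Lemma expected_queries_ge0 (A : ralg R S n) x : (0 <= expected_queries A x)%E.
Proof. by rewrite expected_queriesE integral_ge0. Qed.

Lemma worst_case_queries_ge0 h (A : ralg R S n) : (0 <= worst_case_queries h A)%E.
Proof.
rewrite /worst_case_queries; elim/big_ind: _ => // [x y x0 _|x _].
  by rewrite le_max x0.
exact: expected_queries_ge0.
Qed.

Lemma Rbar_ge0 (eps : R) (h : pfun S n) : (0 <= Rbar eps h)%E.
Proof.
by apply: le_ereal_inf_tmp => _ [A _ <-]; exact: worst_case_queries_ge0.
Qed.

Lemma worst_case_queries_le (h : pfun S n) (A : ralg R S n) c : (0 <= c)%E ->
  (forall x, dom h x -> (expected_queries A x <= c)%E) ->
  (worst_case_queries h A <= c)%E.
Proof.
move=> c0 hc; rewrite /worst_case_queries.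
by elim/big_ind: _ => // x y xc yc; rewrite ge_max xc.
Qed.

Lemma expected_queries_le_worst (h : pfun S n) (A : ralg R S n) x :
  dom h x -> (expected_queries A x <= worst_case_queries h A)%E.
Proof. by move=> hx; rewrite /worst_case_queries (bigD1 x) //= le_max lexx. Qed.

End Costs.

(** [B] draws [j] with probability [w j] and, independently, [t] from [A], then runs [phi j t]: a
    weighted sum of pushforwards of [A]. *)
Lemma ex_mixture (R : realType) (S S' : finType) (n n' : nat) (J : finType)
    (w : J -> R) (phi : J -> dtree S n -> dtree S' n')
    (A : ralg R S n) :
    (forall j, 0 <= w j) -> \sum_j w j = 1 ->
  exists B : ralg R S' n',
    (forall E, B E = \sum_j (w j)%:E * A (phi j @^-1` E)%classic)%E /\
    (forall x, expected_queries B x =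
      \sum_j (w j)%:E * \int[A]_t (nqueries (phi j t) x)%:R%:E)%E.
Proof.
move=> w0 w1.
have mphi j : measurable_fun setT (phi j) by [].
pose m j : {measure set _ -> \bar R} := pushforward A (phi j).
have [M [ME Mh]] := ex_measure_sum (index_enum J) (m mphi) w0.
have M1 : M setT = 1%E.
  rewrite ME /m /=; under eq_bigr do
    rewrite /pushforward preimage_setT probability_setT mule1.
  by rewrite sumEFin w1.
exists (probability_of_measure M1); split=> [E|x]; first exact: ME.
rewrite expected_queriesE -[LHS]/(\int[M]_t _)%E Mh //.
apply: eq_bigr => j _; congr (_ * _)%E.
exact: ge0_integral_pushforward.
Qed.

Lemma sum_integral (R : realType) (S : finType) (n : nat) (A : ralg R S n)
    (J : finType) (w : J -> R) (h : J -> dtree S n -> R) :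
    (forall j, 0 <= w j) -> (forall j t, 0 <= h j t) ->
  (\sum_j (w j)%:E * \int[A]_t (h j t)%:E =
   \int[A]_t (\sum_j w j * h j t)%:E)%E.
Proof.
move=> w0 h0; under [RHS]eq_integral do rewrite -sumEFin.
rewrite ge0_integral_sum //; last by move=> j t _; rewrite lee_fin mulr_ge0.
apply: eq_bigr => j _; under [RHS]eq_integral do rewrite EFinM.
by rewrite ge0_integralZl //= ?lee_fin // => t _; rewrite lee_fin.
Qed.

(** * Decision trees *)

Definition upd (I : finType) (A : Type) (m : {ffun I -> A}) (i : I) (a : A) :
  {ffun I -> A} := [ffun i' => if i' == i then a else m i'].

Lemma upd_upd (I : finType) (A : Type) (m : {ffun I -> A}) i a :
  upd (upd m i a) i (m i) = m.
Proof. by apply/ffunP => j; rewrite !ffunE; case: eqVneq => [->|]. Qed.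

Lemma upd_same (I : finType) (A : Type) (m : {ffun I -> A}) i a :
  upd m i a i = a.
Proof. by rewrite ffunE eqxx. Qed.

Section ReadAll.
Context {S : finType} {n : nat} (h : pfun S n).

Fixpoint read (l : seq 'I_n) (y : {ffun 'I_n -> S}) : dtree S n :=
  if l is i :: l' then Query i (fun c => read l' (upd y i c))
  else Answer (odflt false (h y)).

Lemma nqueries_read l y x : nqueries (read l y) x = size l.
Proof. by elim: l y => //= i l IH y; rewrite IH. Qed.

Lemma output_read l y x :
  output (read l y) x =
  odflt false (h [ffun i => if i \in l then x i else y i]).
Proof.
elim: l y => [|i l IH] y /=; first by congr (odflt _ (h _)); apply/ffunP => i; rewrite ffunE.
rewrite IH; congr (odflt _ (h _)); apply/ffunP => j; rewrite !ffunE in_cons.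
by case: eqVneq => [->|_] //=; case: ifP.
Qed.

End ReadAll.

(** * Running a tree on a pair, and on the sabotaged inputs of that pair *)

Section Sabotage.
Context {k : nat}.
Implicit Types (x y : {ffun 'I_k -> bool}) (p : {ffun 'I_k -> sabchar}).

(* The pair (x, y) stands for the sabotaged input that agrees with x where
   x = y; the run stops as soon as it queries a position where x and y differ. *)
Fixpoint found (t : dtree bool k) x y : bool :=
  if t is Query j next then (x j != y j) || found (next (x j)) x y else false.

Fixpoint cost (t : dtree bool k) x y : nat :=
  if t is Query j next then (if x j == y j then cost (next (x j)) x y else 0%N).+1
  else 0%N.

(** One [Star] or [Dagger] already determines the value of [gsab g]; [Z] starts afresh if [t] ends
    without meeting any. *)
Fixpoint resume (t : dtree bool k) (Z : dtree sabchar k) : dtree sabchar k :=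
  if t is Query j next then
    Query j (fun c => match c with
                      | Bit b => resume (next b) Z
                      | Star => Answer false
                      | Dagger => Answer true
                      end)
  else Z.

(** Positions where [x] and [y] agree may carry [c] too, so a run on [p] can stop earlier than on
    the pair; hence the inequality in [nqueries_resume]. *)
Definition sabotages (c : sabchar) p x y :=
  [/\ forall b, c != Bit b, forall i, p i != c -> p i = Bit (x i)
    & forall i, p i != c -> p i = Bit (y i)].

Lemma gsab_sabotages (g : pfun bool k) p b : gsab g p = Some b ->
  exists x y, [/\ g x = Some false, g y = Some true &
    sabotages (if b then Dagger else Star) p x y].
Proof.
move=> pb; have : p \in sab_inputs (if b then Dagger else Star) g.
  move: pb; rewrite /gsab; case: ifP => [pS [<-] //|_].
  by case: ifP => // pD [<-].
rewrite inE => /existsP[x /existsP[y /and4P[]]]; rewrite /dom.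
case gx: (g x) => [gxb|//] _; case gy: (g y) => [gyb|//] _ gxy /forallP pxy.
set c := if b then _ else _ in pxy *.
have cb b' : c != Bit b' by rewrite /c; case: b {pb pxy c}.
have px i : p i != c -> p i = Bit (x i).
  by move=> pic; move/implyP: (pxy i) => /(_ pic)/andP[/eqP <-].
have py i : p i != c -> p i = Bit (y i).
  by move=> pic; move/implyP: (pxy i) => /(_ pic)/andP[_ /eqP <-].
(* The condition is symmetric in the two inputs, so they can be swapped to give [x] the value 0. *)
case: gxb gyb gx gy gxy => [] [] // gx gy _; first by exists y, x.
by exists x, y.
Qed.

Lemma output_resume (g : pfun bool k) t Z p b : gsab g p = Some b ->
  output Z p = b -> output (resume t Z) p = b.
Proof.
move=> /gsab_sabotages[x [y [_ _ [_ px _]]]] Zp; elim: t => //= j next IH.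
case pj: (p j) => [b'||]; first exact: IH.
- by case: b px {Zp IH} => // /(_ j); rewrite pj => /(_ isT).
- by case: b px {Zp IH} => // /(_ j); rewrite pj => /(_ isT).
Qed.

Lemma nqueries_resume c t Z p x y : sabotages c p x y ->
  (nqueries (resume t Z) p <= cost t x y + ~~ found t x y * nqueries Z p)%N.
Proof.
move=> [cb px py]; elim: t => [b|j next IH] /=; first by rewrite mul1n.
case pj: (p j) => [b||] //=.
have pjc : p j != c by rewrite pj eq_sym.
have := px _ pjc; have := py _ pjc; rewrite pj => -[<-] [<-].
by rewrite eqxx /= addSn ltnS IH.
Qed.

End Sabotage.

(** * Simulating a tree for the composition by a tree for the outer function *)

Section Embedding.
Context {n k : nat}.
Implicit Types (z : {ffun 'I_n -> bool}) (t : dtree bool (n * k)).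
Implicit Types (u : {ffun 'I_(n * k) -> bool}).

Definition pair_index (q : 'I_(n * k)) : 'I_n * 'I_k :=
  enum_val (cast_ord (esym (mxvec_cast n k)) q).

Lemma pair_indexK i j : pair_index (mxvec_index i j) = (i, j).
Proof. by rewrite /pair_index /mxvec_index cast_ordK enum_rankK. Qed.

Variable P : 'I_n -> {ffun 'I_k -> bool} * {ffun 'I_k -> bool}.

Definition side (b : bool) (i : 'I_n) := if b then (P i).2 else (P i).1.

Definition embed z : {ffun 'I_(n * k) -> bool} :=
  [ffun q => side (z (pair_index q).1) (pair_index q).1 (pair_index q).2].

Lemma block_embed z i : block (embed z) i = side (z i) i.
Proof. by apply/ffunP => j; rewrite !ffunE pair_indexK. Qed.

(* [m] holds the bits of the input of [f] that have already been queried. *)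
Fixpoint extract t (m : {ffun 'I_n -> option bool}) : dtree bool n :=
  match t with
  | Answer b => Answer b
  | Query q next =>
      let: (i, j) := pair_index q in
      let ask b := extract (next (side b i j)) (upd m i (Some b)) in
      if (P i).1 j == (P i).2 j then extract (next ((P i).1 j)) m
      else if m i is Some b then ask b else Query i ask
  end.

(* The tree induced by [t] on block [i0] when the other blocks are those of [u]. *)
Fixpoint block_tree i0 u t : dtree bool k :=
  match t with
  | Answer b => Answer b
  | Query q next =>
      let: (i, j) := pair_index q in
      if i == i0 then Query j (fun b => block_tree i0 u (next b))
      else block_tree i0 u (next (u q))
  end.

Lemma eq_block_tree i0 u u' t :
  (forall q, (pair_index q).1 != i0 -> u q = u' q) ->
  block_tree i0 u t = block_tree i0 u' t.
Proof.
move=> uu'; elim: t => //= q next IH.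
case E: (pair_index q) => [i j]; case: eqVneq => [_|ii0].
  by congr Query; apply/funext => b.
by rewrite uu' ?IH // E.
Qed.

Definition consistent (m : {ffun 'I_n -> option bool}) z :=
  forall i b, m i = Some b -> b = z i.

Lemma consistent_upd m z i : consistent m z -> consistent (upd m i (Some (z i))) z.
Proof. by move=> mz i' b; rewrite ffunE; case: eqVneq => [->[]|_ /mz]. Qed.

Lemma embedE z q i j : pair_index q = (i, j) -> embed z q = side (z i) i j.
Proof. by rewrite ffunE => ->. Qed.

Lemma side_eq b i j : (P i).1 j = (P i).2 j -> side b i j = (P i).1 j.
Proof. by rewrite /side; case: b. Qed.

Lemma output_extract t m z : consistent m z ->
  output (extract t m) z = output t (embed z).
Proof.
elim: t m => //= q next IH m mz; case E: (pair_index q) => [i j].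
rewrite (embedE _ E); case: eqP => [Pij|_]; first by rewrite IH // side_eq.
case mi: (m i) => [b|] /=; last by rewrite IH //; exact: consistent_upd.
by rewrite (mz _ _ mi) IH //; exact: consistent_upd.
Qed.

(** An unknown bit [i] is queried once, exactly when the first sabotaged position of block [i] is
    read; until then both sides of the pair give the induced tree the same answers. *)
Lemma nqueries_extract t m z : consistent m z ->
  nqueries (extract t m) z =
  (\sum_(i | m i == None) found (block_tree i (embed z) t) (P i).1 (P i).2)%N.
Proof.
elim: t m => [b|q next IH] m mz /=; first by rewrite big1.
case E: (pair_index q) => [i0 j]; have uq := embedE z E.
case: eqP => [Pij|/eqP Pij].
  rewrite IH //; apply: eq_bigr => i _; rewrite uq side_eq //.
  by case: eqVneq => //= <-; rewrite Pij eqxx.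
have mz' := @consistent_upd _ _ i0 mz.
have upd_pred i : (upd m i0 (Some (z i0)) i == None) = (m i == None) && (i != i0).
  by rewrite ffunE; case: (eqVneq i i0) => _; rewrite ?andbF ?andbT.
have rest : (\sum_(i | upd m i0 (Some (z i0)) i == None)
    found (block_tree i (embed z) (next (side (z i0) i0 j))) (P i).1 (P i).2 =
  \sum_(i | (m i == None) && (i != i0))
    found (if i0 == i then Query j (fun b => block_tree i (embed z) (next b))
           else block_tree i (embed z) (next (embed z q))) (P i).1 (P i).2)%N.
  apply: eq_big => // i; rewrite upd_pred => /andP[_ ii0].
  by rewrite eq_sym (negPf ii0) uq.
case mi: (m i0) => [b|] /=.
  rewrite (mz _ _ mi) IH // rest; apply: eq_bigl => i.
  by case: (eqVneq i i0) => [->|_]; rewrite ?mi ?andbT.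
by rewrite IH // rest [RHS](bigD1 i0) ?mi //= eqxx /= Pij add1n.
Qed.

(** Each query is charged to the block it lies in, and [cost] stops charging a block after its first
    sabotaged position. *)
Lemma sum_cost_le t z :
  (\sum_i cost (block_tree i (embed z) t) (P i).1 (P i).2 <= nqueries t (embed z))%N.
Proof.
elim: t => [b|q next IH] /=; first by rewrite big1.
case E: (pair_index q) => [i0 j]; have uq := embedE z E.
apply: (@leq_trans (\sum_i cost (block_tree i (embed z) (next (embed z q)))
  (P i).1 (P i).2).+1); last by rewrite ltnS.
rewrite (bigD1 i0) //= [X in (_ <= X.+1)%N](bigD1 i0) //= -addSn eqxx /=.
apply: leq_add; last first.
  by apply: leq_sum => i; rewrite eq_sym => /negPf ->.
by rewrite ltnS; case: eqP => // Pij; rewrite uq side_eq.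
Qed.

End Embedding.

(** * The sabotage game *)

Lemma R0_lt_pinfty (R : realType) (S : finType) (n : nat) (h : pfun S n) :
  (R0 R h < +oo)%E.
Proof.
suff [A err cost] : exists2 A : ralg R S n, has_error 0 h A &
    forall x, (expected_queries A x <= n%:R%:E)%E.
  apply: (@le_lt_trans _ _ n%:R%:E); last exact: ltry.
  apply: (@le_trans _ _ (worst_case_queries h A)).
    by apply: ereal_inf_lbound; exists A.
  by apply: worst_case_queries_le => //; rewrite lee_fin.
(* [read] needs an initial string, which a point of the domain supplies; on an empty domain every
   algorithm is errorless. *)
have [[x0 _]|nodom] := pselect (exists x, dom h x); last first.
  exists (dirac (Answer false) : ralg R S n) => [x b hx|x].
    by case: nodom; exists x; rewrite /dom hx.
  by rewrite expected_queriesE integral_dirac //= mule0 lee_fin.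
exists (dirac (read h (enum 'I_n) x0) : ralg R S n) => [x b hx|x].
  rewrite subr0 /= diracE mem_set //=.
  rewrite output_read; suff -> : [ffun i => if i \in enum 'I_n then x i else x0 i] = x.
    by rewrite hx.
  by apply/ffunP => i; rewrite ffunE mem_enum.
rewrite expected_queriesE integral_dirac //= nqueries_read size_enum_ord.
by rewrite diracT mul1e.
Qed.

Section SabotageGame.
Context {R : realType} {k : nat} (g : pfun bool k).

Notation bits := {ffun 'I_k -> bool}.

Definition sabpair :=
  {xy : bits * bits | (g xy.1 == Some false) && (g xy.2 == Some true)}.

(** Payoff of the zero-sum game between trees and pairs; the distribution mu must make its mean
    nonnegative against every tree. *)
Definition gain (r : R) (t : dtree bool k) (s : sabpair) : R :=
  (cost t (val s).1 (val s).2)%:R - r * (found t (val s).1 (val s).2)%:R.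

(* If a mixture [s] of trees had a negative expected gain on every pair, then
   running it and falling back on a nearly optimal algorithm [Z] whenever no
   sabotaged position was met would beat the infimum [r]. *)
Lemma nonneg_comb_gain (r : R) (s : seq (R * dtree bool k)) :
  RS R g = r%:E -> sabpair -> nonneg_comb s ->
  exists i, 0 <= comb (fun t => gain r t i) s.
Proof.
move=> rE i0 s0; apply: contrapT => nex.
have neg i : comb (fun t => gain r t i) s < 0.
  by rewrite ltNge; apply/negP => ci; apply: nex; exists i.
have [i1 _ i1max] := @arg_maxP _ _ _ i0 xpredT (fun i => comb (fun t => gain r t i) s) isT.
pose J := 'I_(size s).
pose a (j : J) := (tnth (in_tuple s) j).1.
pose t (j : J) := (tnth (in_tuple s) j).2.
have a0 j : 0 <= a j by have /allP := s0; apply; exact: mem_tnth.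
have combE h : comb h s = \sum_j a j * h (t j).
  by rewrite /comb big_tnth.
pose W := \sum_j a j.
have W0 : 0 < W.
  rewrite lt_neqAle sumr_ge0 // andbT eq_sym; apply/eqP => W0.
  have := neg i0; rewrite combE big1 ?ltxx // => j _.
  have /psumr_eq0P : W = 0 by []. 
  by move=> -> //; rewrite mul0r.
pose w j := a j / W.
have w0 j : 0 <= w j by rewrite divr_ge0 // ltW.
have w1 : \sum_j w j = 1 by rewrite -mulr_suml divff // gt_eqF.
(* Half the least deficit over all pairs: a fallback of cost below [r + d], together with a mean
   gain of at most [- (2 * d)], gives total cost at most [r - d]. *)
pose d : R := - comb (fun t => gain r t i1) s / W / 2.
have d0 : 0 < d by rewrite !divr_gt0 // oppr_gt0.
have gain_le i : \sum_j w j * gain r (t j) i <= - (2 * d).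
  have -> : \sum_j w j * gain r (t j) i = comb (fun t => gain r t i) s / W.
    by rewrite combE mulr_suml; apply: eq_bigr => j _; rewrite /w mulrAC.
  have -> : - (2 * d) = comb (fun t => gain r t i1) s / W.
    by rewrite /d mulrC divfK ?pnatr_eq0 // mulNr opprK.
  by rewrite ler_pM2r ?invr_gt0 //; exact: i1max.
pose bnd (i : sabpair) : R := \sum_j w j * ((cost (t j) (val i).1 (val i).2)%:R +
  (~~ found (t j) (val i).1 (val i).2)%:R * (r + d)).
have r0 : 0 <= r by rewrite -lee_fin -rE; exact: Rbar_ge0.
have bnd0 i : 0 <= bnd i.
  apply: sumr_ge0 => j _; apply: mulr_ge0 => //; apply: addr_ge0 => //.
  by apply: mulr_ge0 => //; lra.
have bnd_le i : bnd i <= r - d.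
  have natr_neg (b : bool) : (~~ b)%:R = 1 - b%:R :> R.
    by case: b; rewrite ?subrr ?subr0.
  have -> : bnd i = r + d + \sum_j w j * gain r (t j) i -
      \sum_j w j * (found (t j) (val i).1 (val i).2)%:R * d.
    rewrite -[r + d]mul1r -{1}w1 mulr_suml -big_split -sumrB /=.
    by apply: eq_bigr => j _; rewrite /gain natr_neg; ring.
  have := gain_le i.
  have : 0 <= \sum_j w j * (found (t j) (val i).1 (val i).2)%:R * d.
    by apply: sumr_ge0 => j _; apply: mulr_ge0 (ltW d0); apply: mulr_ge0.
  lra.
have [_ [Z Zerr <-] Zlt] : exists2 c,
    [set worst_case_queries (gsab g) A
      | A in [set A : ralg R _ _ | has_error 0 (gsab g) A]]%classic c &
    (c < (r + d)%:E)%E.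
  by apply: ereal_inf_lt; rewrite -[X in (X < _)%E]/(RS R g) rE lte_fin; lra.
have [D [DE Dnq]] := ex_mixture (fun j => resume (t j)) Z w0 w1.
suff : (RS R g <= (r - d)%:E)%E by rewrite rE lee_fin; lra.
apply: (@le_trans _ _ (worst_case_queries (gsab g) D)).
  apply: ereal_inf_lbound; exists D => // p b pb.
  rewrite subr0 DE.
  have -> : (1%:E = \sum_j (w j)%:E * 1 :> \bar R)%E.
    by under eq_bigr do rewrite mule1; rewrite sumEFin w1.
  apply: lee_sum => j _; apply: lee_wpmul2l; first by rewrite lee_fin.
  apply: (@le_trans _ _ (Z [set z | output z p = b]%classic)).
    by have := Zerr _ _ pb; rewrite subr0.
  by apply: le_measure; rewrite ?inE // => z; exact: output_resume pb.
apply: worst_case_queries_le => [|p].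
  by rewrite lee_fin (le_trans (bnd0 i0)).
rewrite /dom; case pb: (gsab g p) => [b|//] _.
have [x [y [gx gy pxy]]] := gsab_sabotages pb.
have xyP : (g (x, y).1 == Some false) && (g (x, y).2 == Some true) by rewrite gx gy !eqxx.
pose i : sabpair := Sub (x, y) xyP.
apply: (@le_trans _ _ (bnd i)%:E); last by rewrite lee_fin.
rewrite Dnq -sumEFin; apply: lee_sum => j _; rewrite [leRHS]EFinM.
apply: lee_wpmul2l; first by rewrite lee_fin.
pose c : R := (cost (t j) x y)%:R; pose e : R := (~~ found (t j) x y)%:R.
apply: (@le_trans _ _ (\int[Z]_z (c%:E + e%:E * (nqueries z p)%:R%:E))%E).
  apply: ge0_le_integral => //.
  move=> z _; rewrite -EFinM -EFinD lee_fin /c /e -natrM -natrD ler_nat.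
  exact: nqueries_resume pxy.
rewrite ge0_integralD //; last 2 first.
- by move=> z _; rewrite lee_fin.
- by move=> z _; rewrite mule_ge0 // lee_fin.
have -> : (\int[Z]__ c%:E = c%:E)%E.
  rewrite (integral_cst Z measurableT c%:E) -[RHS]mule1; congr (_ * _)%E.
  exact: probability_setT.
rewrite ge0_integralZl //; last by rewrite lee_fin.
rewrite EFinD; apply: leeD => //; rewrite EFinM; apply: lee_wpmul2l.
  by rewrite lee_fin.
rewrite -expected_queriesE (le_trans _ (ltW Zlt)) //.
by apply: expected_queries_le_worst; rewrite /dom pb.
Qed.

End SabotageGame.

(** * Composition *)

Section ProductWeight.
Context {R : realType} {n : nat} {I : finType} (mu : I -> R).
Implicit Types P : {ffun 'I_n -> I}.

Definition prod_weight P : R := \prod_i mu (P i).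

Lemma prod_weight_ge0 P : (forall i, 0 <= mu i) -> 0 <= prod_weight P.
Proof. by move=> mu0; exact: prodr_ge0. Qed.

Lemma sum_prod_weight : \sum_i mu i = 1 -> \sum_P prod_weight P = 1.
Proof.
move=> mu1; rewrite -(bigA_distr_bigA (fun (_ : 'I_n) s => mu s)) /=.
by under eq_bigr do rewrite mu1; rewrite prodr_const expr1n.
Qed.

(* The map (P, s) |-> (P with coordinate i set to s, P i) is an involution that
   preserves the weight of (P, s). *)
Lemma sum_prod_weight_resample (i : 'I_n) (F : {ffun 'I_n -> I} -> R) :
    \sum_s mu s = 1 ->
  \sum_P prod_weight P * F P =
  \sum_P prod_weight P * \sum_s mu s * F (upd P i s).
Proof.
move=> mu1; transitivity (\sum_P \sum_s prod_weight P * mu s * F P).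
  apply: eq_bigr => P _; rewrite -mulr_suml -mulr_sumr mu1 mulr1 //.
under [RHS]eq_bigr do rewrite mulr_sumr.
rewrite !pair_bigA /=.
pose swap (Ps : {ffun 'I_n -> I} * I) := (upd Ps.1 i Ps.2, Ps.1 i).
have swapK : involutive swap.
  by move=> [P s]; rewrite /swap /= upd_upd upd_same.
rewrite (reindex_inj (inv_inj swapK)) /=; apply: eq_bigr => -[P s] _ /=.
rewrite mulrA; congr (_ * _).
rewrite /prod_weight (bigD1 i) //= [in RHS](bigD1 i) //= upd_same.
rewrite mulrAC [in RHS]mulrAC [in RHS](mulrC (mu (P i))); congr (_ * _).
by apply: eq_bigr => j /negPf ji; rewrite ffunE ji.
Qed.

End ProductWeight.

Section Blocks.
Context {R : realType} {n k : nat} {g : pfun bool k}.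
Implicit Types (P : {ffun 'I_n -> sabpair g}) (z : {ffun 'I_n -> bool}).

Definition pairs P (i : 'I_n) := val (P i).

Lemma sum_gain_le (r : R) P z (t : dtree bool (n * k)) :
  \sum_i gain r (block_tree i (embed (pairs P) z) t) (P i) <=
  (nqueries t (embed (pairs P) z))%:R -
  r * (nqueries (extract (pairs P) t [ffun=> None]) z)%:R.
Proof.
rewrite /gain sumrB -mulr_sumr -!natr_sum lerB ?ler_nat ?sum_cost_le //.
rewrite nqueries_extract => [|i b]; last by rewrite ffunE.
by rewrite le_eqVlt; apply/orP; left; apply/eqP; congr (_ * _%:R);
   apply: eq_bigl => i; rewrite ffunE eqxx.
Qed.

(** The difference of the two sides dominates the sum of the block gains, and each block gain has
    nonnegative mean once the pair of that block is resampled from [mu]. *)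
Lemma nqueries_extract_le (mu : sabpair g -> R) (r : R) z (t : dtree bool (n * k)) :
    (forall s, 0 <= mu s) -> \sum_s mu s = 1 ->
    (forall t, 0 <= \sum_s mu s * gain r t s) ->
  \sum_P prod_weight mu P *
    (r * (nqueries (extract (pairs P) t [ffun=> None]) z)%:R) <=
  \sum_P prod_weight mu P * (nqueries t (embed (pairs P) z))%:R.
Proof.
move=> mu0 mu1 hmu; rewrite -subr_ge0 -sumrB.
apply: (@le_trans _ _ (\sum_P prod_weight mu P *
  \sum_i gain r (block_tree i (embed (pairs P) z) t) (P i))); last first.
  apply: ler_sum => P _; rewrite -mulrBr ler_wpM2l ?prod_weight_ge0 //.
  exact: sum_gain_le.
under eq_bigr do rewrite mulr_sumr.
rewrite exchange_big /=; apply: sumr_ge0 => i _.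
rewrite (sum_prod_weight_resample i) //.
apply: sumr_ge0 => P _; apply: mulr_ge0; first exact: prod_weight_ge0.
have := hmu (block_tree i (embed (pairs P) z) t); congr (0 <= _).
apply: eq_bigr => s _; rewrite upd_same; congr (_ * gain _ _ _).
(* The induced tree depends only on the other blocks, which resampling the pair of block [i] leaves
   alone. *)
apply: eq_block_tree => q /negPf qi.
by rewrite !ffunE /side /pairs ffunE qi.
Qed.

Lemma compose_embed (f : pfun bool n) P z : compose f g (embed (pairs P) z) = f z.
Proof.
have gE i : g (block (embed (pairs P) z) i) = Some (z i).
  rewrite block_embed /side /pairs; have /andP[/eqP g0 /eqP g1] := valP (P i).
  by case: (z i).
rewrite /compose ifT; last by apply/forallP => i; rewrite /dom gE.
by congr f; apply/ffunP => i; rewrite ffunE gE.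
Qed.

End Blocks.

Theorem theorem21 (R : realType) (n k : nat) (f : pfun bool n) (g : pfun bool k)
    (eps : R) (heps : (0 <= eps)%R) :
  (Rbar eps f * RS R g <= Rbar eps (compose f g))%E.
Proof.
(* Without a pair, [gsab g] has empty domain and [RS R g] is 0. *)
have [[i0 _]|nopair] := pselect (exists i : sabpair g, True); last first.
  suff -> : RS R g = 0%E by rewrite mule0 Rbar_ge0.
  apply/eqP; rewrite eq_le Rbar_ge0 andbT.
  apply: (@le_trans _ _ (worst_case_queries (gsab g)
    (dirac (Answer false) : ralg R sabchar k))).
    apply: ereal_inf_lbound; exists (dirac (Answer false)) => // p b.
    move=> /gsab_sabotages[x [y [gx gy _]]]; case: nopair.
    have xyP : (g (x, y).1 == Some false) && (g (x, y).2 == Some true).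
      by rewrite gx gy !eqxx.
    by exists (Sub (x, y) xyP).
  apply: worst_case_queries_le => // p.
  by rewrite expected_queriesE integral_dirac //= mule0.
have RSfin : (RS R g \is a fin_num)%E.
  by rewrite ge0_fin_numE ?R0_lt_pinfty ?Rbar_ge0.
set r := fine (RS R g).
have rE : RS R g = r%:E by rewrite fineK.
have r0 : 0 <= r by rewrite -lee_fin -rE; exact: Rbar_ge0.
have [mu [mu0 mu1 hmu]] := ville (fun s s0 => nonneg_comb_gain rE i0 s0).
apply: le_ereal_inf_tmp => _ [A Aerr <-].
pose w (P : {ffun 'I_n -> sabpair g}) := prod_weight mu P.
have w0 P : 0 <= w P by exact: prod_weight_ge0.
have w1 : \sum_P w P = 1 by exact: sum_prod_weight.
pose build (P : {ffun 'I_n -> sabpair g}) t := extract (pairs P) t [ffun=> None].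
have [B [BE Bnq]] := ex_mixture build A w0 w1.
apply: (@le_trans _ _ (worst_case_queries f B * r%:E)%E).
  rewrite rE lee_wpmul2r ?lee_fin //; apply: ereal_inf_lbound; exists B => // z b fz.
  rewrite BE.
  have -> : ((1 - eps)%:E = \sum_P (w P)%:E * (1 - eps)%:E)%E.
    by under eq_bigr do rewrite -EFinM; rewrite sumEFin -mulr_suml w1 mul1r.
  (* For each fixed [P] the simulation is correct whenever [A] is correct on the embedded input, so
     averaging over [P] keeps the error bound. *)
  apply: lee_sum => P _; apply: lee_wpmul2l; first by rewrite lee_fin.
  apply: (@le_trans _ _ (A [set t | output t (embed (pairs P) z) = b]%classic)).
    by apply: Aerr; rewrite compose_embed.
  apply: le_measure; rewrite ?inE // => t /= <-.
  by rewrite output_extract // => i c; rewrite ffunE.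
have [rgt0|] := ltP 0 r; last first.
  move=> r_le0; have -> : r = 0 by apply/eqP; rewrite eq_le r_le0.
  by rewrite mule0 worst_case_queries_ge0.
rewrite -lee_pdivlMr //; apply: worst_case_queries_le => [|z fz].
  by rewrite mule_ge0 ?worst_case_queries_ge0 // lee_fin invr_ge0.
rewrite lee_pdivlMr // Bnq sum_integral // muleC -ge0_integralZl //; last first.
  by move=> t _; rewrite lee_fin sumr_ge0 // => P _; rewrite mulr_ge0.
apply: (@le_trans _ _ (\sum_P (w P)%:E *
    \int[A]_t (nqueries t (embed (pairs P) z))%:R%:E)%E).
  rewrite sum_integral //; apply: ge0_le_integral => //.
    by move=> t _; rewrite mule_ge0 // lee_fin sumr_ge0 // => P _; rewrite mulr_ge0.
  move=> t _; rewrite -EFinM lee_fin mulr_sumr.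
  have := nqueries_extract_le z t mu0 mu1 hmu; apply: le_trans.
  by rewrite le_eqVlt; apply/orP; left; apply/eqP; apply: eq_bigr => P _; rewrite mulrCA.
(* Writing the worst case as an average over [P] allows a comparison term by term. *)
have -> : worst_case_queries (compose f g) A =
    (\sum_P (w P)%:E * worst_case_queries (compose f g) A)%E.
  rewrite -ge0_sume_distrl; last by move=> P _; rewrite lee_fin.
  by rewrite sumEFin w1 mul1e.
apply: lee_sum => P _; apply: lee_wpmul2l; first by rewrite lee_fin.
rewrite -expected_queriesE; apply: expected_queries_le_worst.
by rewrite /dom compose_embed.
Qed.
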